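(* Let $D$ be a distributed uncertain database partitioned into uncertain databases $D_1, \dots, D_N$, let $q \in \mathbb{R}^d$ be a query point, and let $k \ge 1$ be an integer. For each uncertain object $t$ let $t.LB$ and $t.UB$ be real numbers that are a lower and an upper bound of its ranking score, i.e. $t.LB \le S(t) \le t.UB$. Fix $l \in \{1,\dots,N\}$, let $S_{cand} = \{t^{(1)}, t^{(2)}, \dots, t^{(k)}\}$ be a set of $k$ (distinct) uncertain objects in $D_l \subseteq D$, and let $\tau_l$ be the $k$-th largest score lower bound among these candidates, i.e. $\tau_l = \min_{1\le i\le k} t^{(i)}.LB$. Then any uncertain object $o \in D_l$ with $o.UB < \tau_l$ can be safely pruned; that is, $o$ does not belong to any PTD answer set over $D$.
   Context: An uncertain object $t$ is a finite set of mutually exclusive instances $\{t_1,\dots,t_{|t|}\}$. Each instance $t_i$ has $d$ real attributes $t_i.A_1,\dots,t_i.A_d$ and an appearance probability $t_i.p \in [0,1]$, with $\sum_{i=1}^{|t|} t_i.p \le 1$. An uncertain database is a finite collection of uncertain objects. A distributed uncertain database $D = \{D_1,\dots,D_N\}$ is a collection of $N$ pairwise disjoint uncertain databases (one per server). We write $t \in D$ if $t \in D_l$ for some $l$. A query point $q$ has real coordinates $q.A_1,\dots,q.A_d$. For instances $u_i$ and $v_j$ of uncertain objects $u$ and $v$, $u_i$ dynamically dominates $v_j$ with respect to $q$, written $u_i \prec_q v_j$, if $|u_i.A_m - q.A_m| \le |v_j.A_m - q.A_m|$ for every $m \in \{1,\dots,d\}$, with strict inequality for at least one $m$. The score of an instance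 $t_j$ of an uncertain object $t\in D$ is $S(t_j) = t_j.p \cdot \sum_{s \in D,\, s \ne t}\ \sum_{s_i \in s} \Pr\{t_j \prec_q s_i\}$, where $\Pr\{t_j \prec_q s_i\}$ equals the appearance probability $s_i.p$ if $t_j \prec_q s_i$ and equals $0$ otherwise. The sum runs over all instances, in the whole database $D$, of objects other than $t$. The ranking score of $t$ is $S(t) = \sum_{j=1}^{|t|} S(t_j)$. A probabilistic top-$k$ dominating (PTD) answer set over $D$ is a set $A \subseteq D$ of $k$ uncertain objects with the highest ranking scores, i.e. $|A| = k$ and $S(u) \ge S(v)$ for all $u \in A$ and $v \in D \setminus A$. *)

(* Defs.v *)
From HB Require Import structures.
From mathcomp Require Import all_boot all_order all_algebra.
From mathcomp Require Import reals.

Set Implicit Arguments.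
Unset Strict Implicit.
Unset Printing Implicit Defensive.

Import Order.TTheory GRing.Theory Num.Theory.
Local Open Scope ring_scope.

(* The instances of an object are indexed, so that distinct instances may carry
   the same attributes and the same probability. *)
Record uncertain_object (R : realType) (d : nat) := UncertainObject {
  ninst : nat;
  attr : 'I_ninst -> 'rV[R]_d;
  prob : 'I_ninst -> R;
  prob_itv : forall i, 0 <= prob i <= 1;
  prob_sum_le1 : \sum_(i < ninst) prob i <= 1
}.

Definition dyn_dominates (R : realType) (d : nat) (q x y : 'rV[R]_d) : bool :=
  [forall m, `|x ord0 m - q ord0 m| <= `|y ord0 m - q ord0 m|] &&
  [exists m, `|x ord0 m - q ord0 m| < `|y ord0 m - q ord0 m|].

(* From here on, T is a type of object names and [obj] gives the contents of
   each named object; equality and membership of objects refer to the names, so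
   two different objects may have identical contents. *)

Definition dominance_prob (R : realType) (d : nat) (T : finType)
    (obj : T -> uncertain_object R d) (q : 'rV[R]_d)
    (t : T) (j : 'I_(ninst (obj t))) (s : T) (i : 'I_(ninst (obj s))) : R :=
  if dyn_dominates q (attr j) (attr i) then prob i else 0.

Definition instance_score (R : realType) (d : nat) (T : finType)
    (obj : T -> uncertain_object R d) (q : 'rV[R]_d) (D : {set T})
    (t : T) (j : 'I_(ninst (obj t))) : R :=
  prob j *
  \sum_(s in D | s != t) \sum_(i < ninst (obj s)) dominance_prob q j i.

Definition ranking_score (R : realType) (d : nat) (T : finType)
    (obj : T -> uncertain_object R d) (q : 'rV[R]_d) (D : {set T})
    (t : T) : R :=
  \sum_(j < ninst (obj t)) instance_score q D j.

Definition PTD_answer (R : realType) (d : nat) (T : finType)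
    (obj : T -> uncertain_object R d) (q : 'rV[R]_d) (D : {set T})
    (k : nat) (A : {set T}) : Prop :=
  [/\ A \subset D, #|A| = k &
      forall u v : T, u \in A -> v \in D :\: A ->
        ranking_score obj q D v <= ranking_score obj q D u].

Definition distributed_db (T : finType) (N : nat) (Ds : 'I_N -> {set T}) :
    {set T} :=
  \bigcup_(l < N) Ds l.

(* The default value of the iterated minimum is one of the values over which it
   is taken, so this is the minimum of [LB (cand i)] over i. *)
Definition lb_threshold (R : realType) (T : finType) (k : nat) (k_gt0 : (0 < k)%N)
    (LB : T -> R) (cand : 'I_k -> T) : R :=
  \big[Num.min/LB (cand (Ordinal k_gt0))]_(i < k) LB (cand i).

(* Main.v *)
Require Import Defs.
From HB Require Import structures.
From mathcomp Require Import all_boot all_order all_algebra.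
From mathcomp Require Import reals.

Set Implicit Arguments.
Unset Strict Implicit.
Unset Printing Implicit Defensive.

Import Order.TTheory GRing.Theory Num.Theory.
Local Open Scope ring_scope.

(** Writing S for the ranking score and tau for the threshold, every candidate c satisfies S(o) <=
    UB o < tau <= LB c <= S(c). An answer set containing o contains every object of the database
    that scores strictly more than o. *)

(* Otherwise all k candidates, scoring strictly more than o, would belong to A
   alongside o, although A has only k elements. *)
Theorem lemma2 (R : realType) (d N : nat) (T : finType)
    (obj : T -> uncertain_object R d)
    (Ds : 'I_N -> {set T})
    (Ds_disjoint : forall l1 l2 : 'I_N, l1 != l2 -> [disjoint Ds l1 & Ds l2])
    (q : 'rV[R]_d) (k : nat) (k_gt0 : (0 < k)%N)
    (LB UB : T -> R)
    (LB_UB : forall t : T, t \in distributed_db Ds ->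
       LB t <= ranking_score obj q (distributed_db Ds) t <= UB t)
    (l : 'I_N) (cand : 'I_k -> T)
    (cand_inj : injective cand)
    (cand_in : forall i : 'I_k, cand i \in Ds l)
    (o : T) (o_in : o \in Ds l)
    (o_lt : UB o < lb_threshold k_gt0 LB cand) :
  forall A : {set T}, PTD_answer obj q (distributed_db Ds) k A -> o \notin A.
Proof.
move=> A [_ cardA topA]; apply/negP => oA.
have in_db t : t \in Ds l -> t \in distributed_db Ds.
  by move=> tl; apply/bigcupP; exists l.
have score_lt i : ranking_score obj q (distributed_db Ds) o <
                  ranking_score obj q (distributed_db Ds) (cand i).
  have /andP[_ oUB] := LB_UB o (in_db o o_in).
  have /andP[candLB _] := LB_UB _ (in_db _ (cand_in i)).
  apply: le_lt_trans oUB (lt_le_trans o_lt (le_trans _ candLB)).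
  exact: bigmin_le_cond.
have candA : [set cand i | i : 'I_k] \subset A.
  (* By contraposition: [topA], applied to [o] in [A] and a candidate outside [A], would reverse
     [score_lt]. *)
  apply/subsetP => _ /imsetP[i _ ->]; apply: contraLR (score_lt i) => candNA.
  by rewrite -leNgt; apply: topA => //; rewrite inE candNA in_db.
(* The candidates are k distinct elements of [A], so they exhaust it; hence [o] is itself a
   candidate and would score strictly more than itself. *)
have /eqP candE : [set cand i | i : 'I_k] == A.
  by rewrite eqEcard candA cardA card_imset // card_ord leqnn.
move: oA; rewrite -candE => /imsetP[i _ oE].
by have := score_lt i; rewrite -oE ltxx.
Qed.
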